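(* Let $G$ be a finite simple graph. Suppose that $\mathcal{Q}_G$ is normal. Then $G$ satisfies all of the following conditions: (i) any two odd antiholes of $\overline{G}$ having no common vertices have a bridge in $\overline{G}$; (ii) any two odd antiholes of $\overline{G}$ of length $\geq 7$ having exactly one common vertex have a bridge in $\overline{G}$; (iii) any odd hole and odd antihole of $\overline{G}$ having no common vertices have a bridge in $\overline{G}$.
   Context: $G$ is a graph on $[n]=\{1,\dots,n\}$; $\overline{G}$ is its complement. A subset $W\subset[n]$ is stable if no two distinct elements of $W$ form an edge of $G$ (the empty set and singletons are stable). With $\rho(W)=\sum_{j\in W}\mathbf{e}_j$, the stable set polytope $\mathcal{Q}_G\subset\mathbb{R}^n$ is the convex hull of the $\rho(W)$ for $W$ stable in $G$. Let $K$ be a field. For an integral convex polytope $\mathcal{P}\subset\mathbb{R}^n$ with $\mathcal{P}\cap\mathbb{Z}^n=\{\mathbf{a}_1,\dots,\mathbf{a}_m\}$, the toric ring $K[\mathcal{P}]$ is the $K$-subalgebra of $K[x_1^{\pm1},\dots,x_n^{\pm1},t]$ generated by the $X^{\mathbf{a}_i}t$ (where $X^{\mathbf{a}}=x_1^{a_1}\cdots x_n^{a_n}$). $\mathcal{P}$ is called normal if $K[\mathcal{P}]$ is a normal domain. A hole of a graph $H$ is an induced cycle of $H$ of length $>3$. An antihole of $H$ is an induced cycle of the complement $\overline{H}$ of length $>3$ (so an antihole of $\overline{G}$ is an induced cycle of $G$ of length $>3$). Holes and antiholes are odd if their length (number of vertices) is odd. For two holes or antiholes $C_1$, $C_2$ of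 $\overline{G}$, a bridge of $C_1$ and $C_2$ in $\overline{G}$ is an edge $\{i,j\}$ of $\overline{G}$ with $i$ a vertex of $C_1$ not in $C_2$ and $j$ a vertex of $C_2$ not in $C_1$. *)

(* Defs.v *)
From mathcomp Require Import all_boot all_order all_algebra.
From mathcomp Require Import classical_sets reals mpoly.

Set Implicit Arguments.
Unset Strict Implicit.
Unset Printing Implicit Defensive.

Import GRing.Theory.
Local Open Scope ring_scope.

Definition is_simple_graph n (G : rel 'I_n) : Prop :=
  ssrbool.symmetric G /\ irreflexive G.

Definition compl_graph n (G : rel 'I_n) : rel 'I_n :=
  fun i j => (i != j) && ~~ G i j.

Definition stable n (G : rel 'I_n) (W : {set 'I_n}) : Prop :=
  forall i j, i \in W -> j \in W -> i != j -> ~~ G i j.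

(** A cycle is given by the list of its vertices in cyclic order; the same
    induced cycle may be represented by several lists (rotations, reversal). *)
Definition induced_cycle n (H : rel 'I_n) (c : seq 'I_n) : Prop :=
  ucycle H c /\
  (forall x y, x \in c -> y \in c -> H x y -> y = next c x \/ y = prev c x).

Definition hole n (H : rel 'I_n) (c : seq 'I_n) : Prop :=
  induced_cycle H c /\ (3 < size c)%N.

Definition antihole n (H : rel 'I_n) (c : seq 'I_n) : Prop :=
  hole (compl_graph H) c.

Definition odd_hole n (H : rel 'I_n) (c : seq 'I_n) : Prop :=
  hole H c /\ odd (size c).

Definition odd_antihole n (H : rel 'I_n) (c : seq 'I_n) : Prop :=
  antihole H c /\ odd (size c).

Definition has_bridge n (H : rel 'I_n) (c1 c2 : seq 'I_n) : Prop :=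
  exists i j : 'I_n,
    [/\ i \in c1, i \notin c2, j \in c2, j \notin c1 & H i j].

Definition convex_hull (R : realType) n (A : set 'rV[R]_n) : set 'rV[R]_n :=
  fun x => exists (k : nat) (p : 'I_k -> 'rV[R]_n) (l : 'I_k -> R),
    [/\ forall i, A (p i), forall i, 0 <= l i, \sum_i l i = 1
      & x = \sum_i l i *: p i].

Definition rho (R : realType) n (W : {set 'I_n}) : 'rV[R]_n :=
  \sum_(j in W) delta_mx 0 j.

Definition stable_set_polytope (R : realType) n (G : rel 'I_n) :
    set 'rV[R]_n :=
  convex_hull (fun x => exists2 W : {set 'I_n}, stable G W & x = rho R W).

Arguments stable_set_polytope R [n] G _.

Section NormalSubring.
Variable L : fieldType.

Inductive subalgebra_gen (K : fieldType) (iota : K -> L) (S : set L) : set L :=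
| SubalgScalar c : subalgebra_gen iota S (iota c)
| SubalgGen u : S u -> subalgebra_gen iota S u
| SubalgAdd u v : subalgebra_gen iota S u -> subalgebra_gen iota S v ->
    subalgebra_gen iota S (u + v)
| SubalgMul u v : subalgebra_gen iota S u -> subalgebra_gen iota S v ->
    subalgebra_gen iota S (u * v).

(** The field of fractions of the subring [A], realized inside [L]. *)
Definition fractions_of (A : set L) : set L :=
  fun u => exists a b, [/\ A a, A b, b != 0 & u = a / b].

Definition integral_over_subring (A : set L) (u : L) : Prop :=
  exists p : {poly L}, [/\ p \is monic, forall i, A p`_i & root p u].

(** [A] is a domain, being contained in the field [L]. *)
Definition normal_domain (A : set L) : Prop :=
  forall u, fractions_of A u -> integral_over_subring A u -> A u.

End NormalSubring.

Section ToricRing.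
Variables (K : fieldType) (n : nat).

(** The rational function field K(x_1, ..., x_n, t). It contains the ring
    K[x_1^{+-1}, ..., x_n^{+-1}, t], so the subalgebra of the latter generated
    by a set of its elements is the one they generate in this field. *)
Definition ratfun : fieldType := {fraction {mpoly K[n.+1]}}.

Definition const_ratfun (c : K) : ratfun := tofrac c%:MP_[n.+1].
Definition xvar (i : 'I_n) : ratfun :=
  tofrac ('X_(widen_ord (leqnSn n) i) : {mpoly K[n.+1]}).
Definition tvar : ratfun := tofrac ('X_ord_max : {mpoly K[n.+1]}).

Definition laurent_monomial (a : 'rV[int]_n) : ratfun :=
  \prod_(i < n) xvar i ^ a 0 i.

Variable R : realType.

Definition lattice_point (P : set 'rV[R]_n) (a : 'rV[int]_n) : Prop :=
  P (map_mx intr a).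

Definition toric_ring (P : set 'rV[R]_n) : set ratfun :=
  subalgebra_gen const_ratfun
    (fun u => exists2 a, lattice_point P a & u = laurent_monomial a * tvar).

Definition normal_polytope (P : set 'rV[R]_n) : Prop :=
  normal_domain (toric_ring P).

End ToricRing.

(* Main.v *)
(* If [2w] is a sum of [2d] indicator vectors of stable sets, then [X^w t^d]
   lies in the fraction field of the toric ring and its square in the toric
   ring; so normality makes [w] itself a sum of [d] indicators. Suppose that
   there is no bridge. As antiholes of the complement are induced cycles of [G],
   every edge between [V1 \ V2] and [V2 \ V1] is present in [G], so each of the
   [d] stable sets serves only one side. For (i), [w] is 1 on both odd cycles
   and [d = 5]: an odd cycle of length at least 5 is covered twice by five stable
   sets, but covering it once needs three sets, and [3 + 3 > 5]. For (ii), [w] is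
   moreover 3 at the common vertex [v]: one side gets at most two sets, which
   cover its path without ever containing [v], so the other side has three sets
   containing [v] and a fourth one for a neighbour of [v]. For (iii), a hole of
   length [2k+1] in the complement is covered twice by its [2k+1] edges, and
   [d = k+3], but covering it once needs [k+1] sets, and [(k+1) + 3 > k+3]. *)
Require Import Defs.
From mathcomp Require Import all_boot all_order all_algebra.
From mathcomp Require Import classical_sets reals mpoly.
From mathcomp Require Import zify.

(** * Exponents of the toric ring as sums of stable sets *)

Section StableSums.
Set Implicit Arguments.
Unset Strict Implicit.
Import Order.TTheory GRing.Theory Num.Theory.
Local Open Scope ring_scope.

Variables (R : realType) (K : fieldType) (n : nat) (G : rel 'I_n).

(** A list allows repetitions; the pairs [(w, d)] form the semigroup of exponents of the toric
    ring. *)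
Definition stable_sum (w : 'I_n -> nat) (d : nat) : Prop :=
  exists s : seq {set 'I_n},
    [/\ forall W, W \in s -> stable G W, size s = d
      & forall i, count (fun W : {set 'I_n} => i \in W) s = w i].

Local Notation wid := (widen_ord (leqnSn n)).

(** The exponent of [X^w t^d]; as in [tvar], the last variable is [t]. *)
Definition mon (w : 'I_n -> nat) (d : nat) : 'X_{1..n.+1} :=
  (\sum_(i < n) U_(wid i) *+ w i + U_(ord_max) *+ d)%MM.

Local Notation toric := (@toric_ring K n R (stable_set_polytope R G)).
Local Notation X w d := (tofrac 'X_[mon w d] : ratfun K n).

Lemma mon_wid w d i : mon w d (wid i) = w i.
Proof.
rewrite mnmDE mnm_sumE (bigD1 i) //= !mulmnE !mnm1E eqxx mul1n.
rewrite big1 ?addn0 => [|j ji]; last first.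
  rewrite mulmnE mnm1E (_ : wid j == wid i = false) //.
  by apply/negbTE; apply: contra ji => /eqP /(congr1 val) /= /val_inj ->.
by rewrite -val_eqE /= (gtn_eqF (ltn_ord i)) mul0n addn0.
Qed.

Lemma mon_max w d : mon w d ord_max = d.
Proof.
rewrite mnmDE mnm_sumE mulmnE mnm1E eqxx mul1n big1 // => i _.
by rewrite mulmnE mnm1E -val_eqE /= (ltn_eqF (ltn_ord i)).
Qed.

Lemma eq_mon w w' d : w =1 w' -> mon w d = mon w' d.
Proof. by move=> ww'; congr (_ + _)%MM; apply: eq_bigr => i _; rewrite ww'. Qed.

Lemma monD w w' d d' :
  X (fun i => w i + w' i)%N (d + d') = X w d * X w' d'.
Proof.
rewrite -tofracM -mpolyXD; congr (tofrac 'X_[_]); apply/mnmP => j.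
rewrite /mon !mnmDE !mnm_sumE !mulmnE mulnDr addnACA -big_split.
by congr (_ + _)%N; apply: eq_bigr => i _; rewrite /= !mulmnE mulnDr.
Qed.

Lemma mon_laurent w (a : 'rV[int]_n) : (forall i, a 0 i = (w i)%:Z) ->
  laurent_monomial K a * tvar K n = X w 1%N.
Proof.
move=> aw; rewrite mpolyXD tofracM; congr (_ * _).
rewrite -mprodXnE rmorph_prod; apply: eq_bigr => i _.
by rewrite aw -exprnP rmorphXn.
Qed.

Lemma rhoE (W : {set 'I_n}) i : rho R W 0 i = (i \in W)%:R.
Proof.
rewrite /rho summxE; have [iW|iW] := boolP (i \in W).
  rewrite (bigD1 i) //= mxE !eqxx big1 ?addr0 // => j /andP[_ ji].
  by rewrite mxE eqxx eq_sym (negbTE ji).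
rewrite big1 // => j jW; rewrite mxE eqxx.
by case: eqVneq iW jW => // -> /negbTE->.
Qed.

(** A point [p i0] of positive weight pins each coordinate: the other terms keep [a 0 j] in (0, 1]
    if [j] is in [W] and in [0, 1) otherwise, and [a 0 j] is an integer. *)
Lemma lattice_point_stable (a : 'rV[int]_n) :
  lattice_point (stable_set_polytope R G) a ->
  exists2 W, stable G W & forall i, a 0 i = (i \in W).
Proof.
case=> k [p [l [Ap l0 l1 aE]]].
have [i0 li0] : exists i, 0 < l i.
  apply/existsP; apply: contraT; rewrite negb_exists => /forallP nl.
  suff : \sum_i l i = 0 by rewrite l1 => /eqP; rewrite oner_eq0.
  by apply: big1 => i _; apply/eqP; rewrite eq_le l0 andbT leNgt nl.
have [W sW pW] := Ap i0; exists W => // j.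
have p01 i : 0 <= p i 0 j <= 1.
  by have [V _ ->] := Ap i; rewrite rhoE ler0n lern1; case: (j \in V).
have /(congr1 (fun M : 'rV[R]_n => M 0 j)) := aE; rewrite mxE summxE.
under eq_bigr do rewrite mxE.
have rest_ge0 : 0 <= \sum_(i | i != i0) l i * p i 0 j.
  by apply: sumr_ge0 => i _; rewrite mulr_ge0 ?l0 //; case/andP: (p01 i).
have rest_le : \sum_(i | i != i0) l i * p i 0 j <= 1 - l i0.
  have <- : \sum_(i | i != i0) l i = 1 - l i0.
    by rewrite -l1 [in RHS](bigD1 i0) //= addrAC subrr add0r.
  apply: ler_sum => i _.
  by rewrite ler_piMr ?l0 //; case/andP: (p01 i).
rewrite (bigD1 i0) //= pW rhoE.
case: (j \in W); rewrite ?mulr1 ?mulr0 ?add0r => aj.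
  have : 0 < (a 0 j)%:~R :> R by rewrite aj ltr_wpDr.
  have : (a 0 j)%:~R <= 1%:~R :> R.
    by rewrite aj -lerBrDl.
  rewrite ler_int ltr0z; lia.
have : 0 <= (a 0 j)%:~R :> R by rewrite aj.
have : (a 0 j)%:~R < 1%:~R :> R.
  by rewrite aj (le_lt_trans rest_le) // ltrBlDr ltrDl.
rewrite ltr_int ler0z; lia.
Qed.

Lemma toric_ring_const c : toric (const_ratfun n c).
Proof. exact: SubalgScalar. Qed.

Lemma toric_ring_gen W : stable G W -> toric (X (fun i => i \in W) 1%N).
Proof.
move=> sW; apply: SubalgGen; exists (\row_i (i \in W)%:Z).
  exists 1%N, (fun=> rho R W), (fun=> 1); split=> //; try by rewrite big_ord1.
    by move=> _; exists W.
  by rewrite big_ord1 scale1r; apply/rowP => i; rewrite rhoE !mxE pmulrn.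
by rewrite (@mon_laurent (fun i => i \in W)) // => i; rewrite mxE.
Qed.

Lemma toric_ring_mon w d : stable_sum w d -> toric (X w d).
Proof.
case=> s [ss <- sw]; rewrite -(eq_mon _ sw) => {w d sw}.
elim: s ss => [|W s IHs] ss.
  rewrite (_ : mon _ _ = 0%MM) ?mpolyX0.
    by rewrite -mpolyC1; exact: toric_ring_const.
  by apply/mnmP => j; rewrite mnmDE mnm_sumE mulmnE muln0 big1.
rewrite (_ : tofrac _ = X (fun i => i \in W) 1%N *
  X (fun i => count (fun W : {set 'I_n} => i \in W) s) (size s)).
  apply: SubalgMul; first by apply: toric_ring_gen; apply: ss; rewrite mem_head.
  by apply: IHs => V Vs; apply: ss; rewrite inE Vs orbT.
by rewrite -monD.
Qed.

(** Having only such exponents in the support passes from the generators to sums and products, and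
    the support of a monomial is its own exponent. *)
Lemma mon_toric_ring w d : toric (X w d) -> stable_sum w d.
Proof.
pose P (m : 'X_{1..n.+1}) := stable_sum (fun i => m (wid i)) (m ord_max).
have supp v : toric v ->
    exists2 p : {mpoly K[n.+1]}, v = tofrac p & {in msupp p, forall m, P m}.
  elim=> [c|_ [a] /lattice_point_stable[W sW aW] ->
         |_ _ _ [p -> Pp] _ [q -> Pq]|_ _ _ [p -> Pp] _ [q -> Pq]].
  - exists c%:MP => // m; rewrite msuppC.
    case: ifP => // _; rewrite inE => /eqP->.
    by exists [::]; split; rewrite ?mnm0E // => i; rewrite mnm0E.
  - exists 'X_[mon (fun i => i \in W) 1].
      by rewrite (@mon_laurent (fun i => i \in W)).
    move=> m; rewrite msuppX inE => /eqP->.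
    exists [:: W]; rewrite mon_max; split=> //.
      by move=> V; rewrite inE => /eqP->.
    by move=> i; rewrite mon_wid /= addn0.
  - exists (p + q); rewrite ?tofracD // => m /msuppD_le; rewrite mem_cat.
    by case/orP => [/Pp|/Pq].
  exists (p * q); rewrite ?tofracM // => m /msuppM_le.
  case/allpairsP=> [[m1 m2] /= [/Pp P1 /Pq P2 ->]].
  case: P1 P2 => [s1 [st1 sz1 c1]] [s2 [st2 sz2 c2]]; exists (s1 ++ s2); split.
  - by move=> W; rewrite mem_cat => /orP[/st1|/st2].
  - by rewrite size_cat sz1 sz2 mnmDE.
  by move=> i; rewrite count_cat c1 c2 mnmDE.
case/supp => p /eqP; rewrite tofrac_eq => /eqP <- /(_ (mon w d)).
rewrite msuppX inE eqxx => /(_ isT) [s [ss]]; rewrite mon_max => sd sw.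
by exists s; split=> // i; rewrite sw mon_wid.
Qed.

(** Singletons are stable, so some [X^w t^e] is in the toric ring; it yields the numerator of a
    fraction equal to [X^w t^d]. *)
Lemma stable_sum_singletons w : exists d, stable_sum w d.
Proof.
pose s := flatten [seq nseq (w i) [set i] | i <- index_enum 'I_n].
exists (size s), s; split=> // [W /flatten_mapP[i _]|j].
  rewrite mem_nseq => /andP[_ /eqP-> x y]; rewrite !inE => /eqP-> /eqP->.
  by rewrite eqxx.
rewrite count_flatten sumnE !big_map (bigD1 j) //= big1 => [|i ij].
  by rewrite count_nseq inE eqxx mul1n addn0.
by rewrite count_nseq inE eq_sym (negbTE ij) mul0n.
Qed.

Lemma stable_sum_nil d : stable_sum (fun=> 0%N) d.
Proof.
exists (nseq d finset.set0); split=> [W||i]; last first.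
- by rewrite count_nseq inE mul0n.
- by rewrite size_nseq.
by rewrite mem_nseq => /andP[_ /eqP-> x y]; rewrite inE.
Qed.

(* [X^w t^d] lies in the fraction field, since [x_i t] and [t] belong to the
   toric ring, and its square lies in the toric ring. *)
Lemma stable_sum_half w d : normal_polytope K (stable_set_polytope R G) ->
  stable_sum (fun i => w i + w i)%N (d + d) -> stable_sum w d.
Proof.
move=> nQ sq; apply: mon_toric_ring; apply: nQ.
  have [e we] := stable_sum_singletons w.
  exists (X w (e + d)), (X (fun=> 0%N) e); split.
  - have -> : X w (e + d) = X w e * X (fun=> 0%N) d.
      rewrite -monD; congr (tofrac 'X_[_]).
      by apply: eq_mon => i; rewrite addn0.
    by apply: SubalgMul; apply: toric_ring_mon => //; exact: stable_sum_nil.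
  - by apply: toric_ring_mon; exact: stable_sum_nil.
  - by rewrite tofrac_eq0 -msupp_eq0 msuppX.
  have -> : X w (e + d) = X w d * X (fun=> 0%N) e.
    rewrite -monD addnC; congr (tofrac 'X_[_]).
    by apply: eq_mon => i; rewrite addn0.
  by rewrite mulfK // tofrac_eq0 -msupp_eq0 msuppX.
have AN1 : toric (-1).
  have := toric_ring_const (-1).
  by rewrite /const_ratfun mpolyCN mpolyC1 rmorphN1.
have A1 : toric 1.
  by have := toric_ring_const 1; rewrite /const_ratfun mpolyC1 tofrac1.
have A0 : toric 0.
  by have := toric_ring_const 0; rewrite /const_ratfun mpolyC0 tofrac0.
have Asq : toric (X w d * X w d) by rewrite -monD; exact: toric_ring_mon.
exists ('X^2 - (X w d * X w d)%:P); split.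
- exact: monicXnsubC.
- move=> i; rewrite coefB coefXn coefC; apply: SubalgAdd; first by case: eqP.
  by case: eqP; rewrite ?oppr0 // -mulN1r => _; apply: SubalgMul.
by rewrite rootE !hornerE subrr.
Qed.

End StableSums.

(** * Fivefold colourings of odd induced cycles *)

Section Cycles.
Set Implicit Arguments.
Unset Strict Implicit.

Variables (n : nat) (G : rel 'I_n).

Lemma stable_sumD w w' d d' : stable_sum G w d -> stable_sum G w' d' ->
  stable_sum G (fun i => w i + w' i) (d + d').
Proof.
case=> [s1 [st1 <- c1]] [s2 [st2 <- c2]]; exists (s1 ++ s2); split.
- by move=> W; rewrite mem_cat => /orP[/st1|/st2].
- exact: size_cat.
by move=> i; rewrite count_cat c1 c2.
Qed.

Lemma eq_stable_sum w w' d : w =1 w' -> stable_sum G w d -> stable_sum G w' d.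
Proof. by move=> ww' [s [st sz cs]]; exists s; split=> // i; rewrite -ww'. Qed.

Lemma index_next (T : eqType) (c : seq T) x : uniq c -> x \in c ->
  index (next c x) c =
  if (index x c).+1 < size c then (index x c).+1 else 0.
Proof.
case: c => // y p uc xc; have := xc; rewrite -index_mem => lt_x.
rewrite next_nth xc; case: ltnP => [lt|ge].
  by rewrite (_ : nth y p _ = nth y (y :: p) (index x (y :: p)).+1) ?index_uniq.
(* After the last vertex, [next] falls back on the default [y], the head of the list. *)
by rewrite nth_default ?index_head.
Qed.

Lemma next3_neq (T : eqType) (c : seq T) x : uniq c -> 3 < size c -> x \in c ->
  next c (next c (next c x)) != x.
Proof.
move=> uc c4 xc; apply/eqP => /(congr1 (index^~ c)).
have idx y : y \in c -> index (next c y) c = (index y c).+1 \/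
    index (next c y) c = 0 /\ size c = (index y c).+1.
  move=> yc; rewrite index_next //; case: ltnP => [_|ge]; [by left | right].
  by split=> //; apply/eqP; rewrite eqn_leq ge index_mem.
have := idx _ xc; have := idx (next c x); have := idx (next c (next c x)).
rewrite !mem_next xc => /(_ isT) h3 /(_ isT) h2 h1 /= h.
by rewrite h in h3; move: c4; lia.
Qed.

(** An edge of an induced cycle joins consecutive vertices, so it is enough that [f] never holds at
    two consecutive positions, cyclically. *)
Lemma hole_color_stable c (f : pred nat) : hole G c ->
  (forall i, i.+1 < size c -> ~~ (f i && f i.+1)) ->
  ~~ (f (size c).-1 && f 0) ->
  stable G [set x in c | f (index x c)].
Proof.
case=> [[/andP[_ uc] indc] _] fS f0.
have f_next x : x \in c -> ~~ (f (index x c) && f (index (next c x) c)).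
  move=> xc; rewrite index_next //; case: ltnP => [/fS //|ge].
  have := xc; rewrite -index_mem => lt.
  have -> // : index x c = (size c).-1.
  by have /eqP <- : (index x c).+1 == size c by rewrite eqn_leq lt ge.
move=> x y; rewrite !inE => /andP[xc fx] /andP[yc fy] _; apply/negP => Gxy.
case: (indc x y xc yc Gxy) => [yE|yE].
  by have := f_next x xc; rewrite -yE fx fy.
by have := f_next y yc; rewrite yE next_prev // -yE fx fy.
Qed.

(** [col i] lists the colours at position [i]; the classes of the colours 1 to 5 are the five stable
    sets. *)
Lemma hole_coloring (col : nat -> seq nat) c : hole G c ->
  (forall i q, i.+1 < size c -> ~~ ((q \in col i) && (q \in col i.+1))) ->
  (forall q, ~~ ((q \in col (size c).-1) && (q \in col 0))) ->
  stable_sum G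
    (fun x => (x \in c) * count (fun q => q \in col (index x c)) (iota 1 5)) 5.
Proof.
move=> hc colS col0.
exists [seq [set x in c | q \in col (index x c)] | q <- iota 1 5].
split=> [W /mapP[q _ ->]|//|x].
  exact: (hole_color_stable (f := fun i => q \in col i) hc
            (fun i => colS i q) (col0 q)).
rewrite count_map; case xc: (x \in c); last first.
  rewrite mul0n (eq_count (a2 := pred0)) ?count_pred0 // => q.
  by rewrite /= inE xc.
by rewrite mul1n; apply: eq_count => q; rewrite /= inE xc.
Qed.

(* A homomorphism from the odd cycle to the Petersen graph, whose vertices are
   the pairs of colours and whose edges join disjoint pairs; in
   [petersen_walk3], vertex 0 gets three colours. *)
Definition petersen_walk (i : nat) : seq nat :=
  match i with
  | 0 => [:: 4; 5] | 1 => [:: 1; 2] | 2 => [:: 3; 4] | 3 => [:: 1; 5]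
  | _ => if odd i then [:: 4; 5] else [:: 2; 3]
  end.

Definition petersen_walk3 (i : nat) : seq nat :=
  match i with
  | 0 => [:: 1; 2; 3] | 1 => [:: 4; 5] | 2 => [:: 1; 2] | 3 => [:: 3; 4]
  | 4 => [:: 1; 5] | _ => if odd i then [:: 2; 3] else [:: 4; 5]
  end.

Lemma odd_hole_coloring c : odd_hole G c ->
  stable_sum G (fun x => 2 * (x \in c)) 5.
Proof.
move=> [hc oc]; have c3 := hc.2; have c5 : 4 < size c.
  by move: oc c3; case: (size c) => [|[|[|[|[|]]]]].
apply: eq_stable_sum (hole_coloring (col := petersen_walk) hc _ _)
  => [x|i q _|q].
- rewrite mulnC; congr (_ * _); case: (index x c) => [|[|[|[|[|i]]]]] //=.
  by case: (odd i).
(* Only the colours 0 to 5 need checking: a larger [q] is in no list. *)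
- case: i => [|[|[|[|[|i]]]]]; rewrite /= ?inE;
    by case: (odd _) => //=; rewrite ?inE; do 6?[case: q => [|q] //].
(* The last position is even and at least 4, so its pair is disjoint from that of position 0. *)
have -> : petersen_walk (size c).-1 = [:: 2; 3].
  move: oc c5; case: (size c) => [|[|[|[|[|k]]]]] //=.
  by rewrite !negbK => /negbTE->.
by rewrite !inE; do 6?[case: q => [|q] //].
Qed.

Lemma odd_hole_coloring3 v c : odd_hole G (v :: c) -> 7 <= size (v :: c) ->
  stable_sum G (fun x => (x == v) + 2 * (x \in v :: c)) 5.
Proof.
move=> [hc oc] c7.
apply: eq_stable_sum (hole_coloring (col := petersen_walk3) hc _ _)
  => [x|i q _|q].
- have := index_mem x (v :: c); rewrite inE /= eq_sym; case: eqVneq => //= _ _.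
  rewrite mulnC; congr (_ * _); case: (index x c) => [|[|[|[|[|i]]]]] //=.
  by case: (odd i).
- case: i => [|[|[|[|[|i]]]]]; rewrite /= ?inE;
    by case: (odd _) => //=; rewrite ?inE; do 6?[case: q => [|q] //].
(* The last position is even and at least 6; at length 5 the walk would end on [[:: 1; 5]], which
   meets [[:: 1; 2; 3]]. *)
have -> : petersen_walk3 (size (v :: c)).-1 = [:: 4; 5].
  move: oc c7 => /=; case: (size c) => [|[|[|[|[|k]]]]] //=.
  by rewrite !negbK => ->.
by rewrite !inE; do 6?[case: q => [|q] //].
Qed.

(** * How many stable sets cover an odd cycle *)

Definition covers (s : seq {set 'I_n}) (c : seq 'I_n) : Prop :=
  {in c, forall x, has (fun W : {set 'I_n} => x \in W) s}.

Definition all_stable (s : seq {set 'I_n}) : Prop :=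
  {in s, forall W, stable G W}.

Hypothesis simpleG : is_simple_graph G.

Lemma stable_edge W x y : stable G W -> G x y -> x \in W -> y \notin W.
Proof.
move=> sW Gxy xW; apply/negP => yW; move: (sW _ _ xW yW); rewrite Gxy.
by case: eqVneq Gxy => [->|_ _ /(_ isT)]; rewrite ?simpleG.2.
Qed.

(** Neither set contains both ends of an edge and each vertex is in one of them, so membership in
    [S1] flips at every edge. *)
Lemma two_stable_path (S1 S2 : {set 'I_n}) y p : stable G S1 -> stable G S2 ->
  path G y p -> {in y :: p, forall x, (x \in S1) || (x \in S2)} ->
  (last y p \in S1) = odd (size p) (+) (y \in S1).
Proof.
move=> st1 st2; elim: p y => [//|z p IHp] y /= /andP[Gyz pz] cov.
rewrite IHp // => [|x xp]; last by apply: cov; rewrite inE xp orbT.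
have := cov y; have := cov z.
rewrite !inE !eqxx orbT => /(_ isT) cz /(_ isT) cy.
have /implyP := stable_edge st1 Gyz; have /implyP := stable_edge st2 Gyz.
by case: (y \in S1) cy; case: (z \in S1) cz; case: (y \in S2);
  case: (z \in S2); case: (odd _).
Qed.

(* Two stable sets covering the cycle minus [v] alternate along a path of even
   order, so that [v] has a neighbour in each of them. *)
Lemma odd_cycle_cover v c s : odd_hole G (v :: c) -> all_stable s ->
  covers s c ->
  let k := count (fun W : {set 'I_n} => v \in W) s in
  [/\ 1 < size s, k < size s & size s <= 2 -> k = 0].
Proof.
case=> [[[/andP[cyc uc] _] c4] oc] st cov k.
case: c cyc uc c4 oc cov => [//|y [//|z p]].
rewrite [cycle _ _]/= rcons_path => /and4P[Gvy Gyz pz Glv] uc _ oc cov.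
have edge x x' W : G x x' -> W \in s -> x \in W -> x' \notin W.
  by move=> Gx Ws; apply: stable_edge => //; apply: st.
have /hasP[Wy Wys yWy] := cov y (mem_head _ _).
have /hasP[Wz Wzs zWz] : has (fun W : {set 'I_n} => z \in W) s.
  by apply: cov; rewrite !inE eqxx orbT.
split.
- rewrite ltnNge; apply/negP => s1.
  case: s s1 Wys Wzs {k st cov edge} (edge _ _ _ Gyz Wys yWy) => [//|W [|//]] _.
  by rewrite !inE => /eqP-> /eqP<-; rewrite zWz.
(* A set that contains the neighbour [y] of [v] misses [v]. *)
- have := count_predC (fun W : {set 'I_n} => v \in W) s; rewrite -/k => <-.
  rewrite -[X in X < _]addn0 ltn_add2l -has_count; apply/hasP; exists Wy => //=.
  by apply/negP => /(edge _ _ _ Gvy Wys); rewrite yWy.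
(* The list is padded with the empty set, so that [S 0] and [S 1] always make sense. *)
move=> s2; pose S i := nth finset.set0 s i.
have stS i : stable G (S i).
  case: (ltnP i (size s)) => [lt|ge]; first exact/st/mem_nth.
  by rewrite /S nth_default // => x x'; rewrite inE.
have covS x : x \in y :: z :: p -> (x \in S 0) || (x \in S 1).
  move=> /cov; rewrite /S; case: (s) s2 => [//|W [|W' [|//]]] _ /=.
    by rewrite orbF => ->.
  by rewrite orbF.
(* The path has an odd number of edges, so exactly one of its ends is in [S 0], and the other is in
   [S 1]; both ends are neighbours of [v]. *)
have := two_stable_path (stS 0) (stS 1) (y := y) (p := z :: p).
rewrite /= Gyz pz => /(_ isT covS).
move: oc; rewrite /= !negbK => -> /=.
set l := last z p; move=> lE.
have ly : (l \in S 0) || (l \in S 1) by apply: covS; rewrite inE mem_last orbT.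
have yy : (y \in S 0) || (y \in S 1) by apply: covS; rewrite mem_head.
have vS i : (y \in S i) || (l \in S i) -> v \notin S i.
  move=> yl; apply/negP => vS; case/orP: yl => [yS|lS].
    by have := stable_edge (stS i) Gvy vS; rewrite yS.
  by have := stable_edge (stS i) Glv lS; rewrite vS.
have v0 : v \notin S 0 by apply: vS; rewrite lE; case: (y \in S 0).
have v1 : v \notin S 1.
  apply: vS; move: ly yy; rewrite lE.
  by case: (y \in S 0); case: (y \in S 1); case: (l \in S 1).
move: v0 v1; rewrite /k /S; case: (s) s2 => [//|W [|W' [|//]]] _ /=.
  by move=> /negbTE->.
by move=> /negbTE-> /negbTE->.
Qed.

Lemma odd_hole_rot v c : odd_hole G c -> v \in c ->
  exists2 c', odd_hole G (v :: c') & perm_eq (v :: c') c.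
Proof.
move=> [[[uc indc] c4] oc] /rot_to[i c' cE].
exists c'; last by rewrite -cE perm_rot.
have cu : uniq c by case/andP: uc.
rewrite -cE; split; last by rewrite size_rot.
split; last by rewrite size_rot.
split; first by rewrite rot_ucycle.
by move=> x y; rewrite !mem_rot next_rot // prev_rot //; apply: indc.
Qed.

End Cycles.

(** * Holes of the complement covered by stable sets *)

Section ComplementHoles.
Set Implicit Arguments.
Unset Strict Implicit.

Variables (n : nat) (G : rel 'I_n).

Lemma compl_graphK : is_simple_graph G -> compl_graph (compl_graph G) = G.
Proof.
move=> [_ irr]; apply/boolp.funext => i; apply/boolp.funext => j.
by rewrite /compl_graph; case: eqVneq => [->|_] /=; rewrite ?irr ?negbK.
Qed.

(** The edges of the cycle are non-edges of [G], hence stable pairs, and each vertex is on two of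
    them. *)
Lemma hole_compl_edges c : hole (compl_graph G) c -> is_simple_graph G ->
  stable_sum G (fun x => 2 * (x \in c)) (size c).
Proof.
move=> [[/andP[cyc uc] indc] c4] [symG _].
exists [seq [set x; next c x] | x <- c]; split=> [W /mapP[x xc ->]||i].
- have /andP[_ nG] := next_cycle cyc xc.
  move=> u v; rewrite !inE => /orP[]/eqP-> /orP[]/eqP->; rewrite ?eqxx //.
  by rewrite symG.
- exact: size_map.
rewrite count_map.
have Ei : {in c, (fun x => i \in [set x; next c x]) =1
                 predU (pred1 i) (pred1 (prev c i))}.
  move=> x xc /=; rewrite !inE [in LHS]eq_sym; congr (_ || _).
  by apply/eqP/eqP => [->|->]; rewrite ?prev_next ?next_prev.
(* The two edges at [i] differ, since [prev c i = i] would be a loop in the complement. *)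
have I0 : count (predI (pred1 i) (pred1 (prev c i))) c = 0.
  apply/eqP; rewrite -leqn0 leqNgt -has_count; apply/negP => /hasP[x xc] /=.
  case/andP=> /eqP xi /eqP pi; rewrite xi in xc pi.
  by have /andP[/eqP] := prev_cycle cyc xc; rewrite -pi.
rewrite (eq_in_count Ei); have := count_predUI (pred1 i) (pred1 (prev c i)) c.
by rewrite I0 addn0 !count_uniq_mem // mem_prev => ->; case: (i \in c).
Qed.

(** A stable set of [G] is a clique of the complement, and an induced cycle of length at least 4 has
    no triangle. *)
Lemma stable_hole_compl c W : hole (compl_graph G) c -> stable G W ->
  count (mem W) c <= 2.
Proof.
move=> [[/andP[cyc uc] indc] c4] sW.
have [/hasP[x xc xW]|/negbTE] := boolP (has (mem W) c); last first.
  by rewrite has_count lt0n => /negbFE/eqP->.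
have near y : y \in c -> y \in W -> [|| y == x, y == next c x | y == prev c x].
  move=> yc yW; case: eqVneq => //= yx; have xy : x != y by rewrite eq_sym.
  have Hxy : compl_graph G x y by rewrite /compl_graph xy sW.
  by case: (indc x y xc yc Hxy) => ->; rewrite eqxx ?orbT.
have [t tW] : exists t, {subset filter (mem W) c <= [:: x; t]}.
  have [nW|nW] := boolP (next c x \in W); last first.
    exists (prev c x) => y.
    rewrite mem_filter !inE => /andP[/= yW /near-/(_ yW)].
    by case/or3P=> [->//|/eqP yE|->]; rewrite ?orbT // -yE yW in nW *.
  exists (next c x) => y; rewrite mem_filter !inE => /andP[/= yW /near-/(_ yW)].
  case/or3P=> /eqP yE; rewrite ?yE ?eqxx ?orbT //.
  have [_|pn] := eqVneq (prev c x) (next c x); first by rewrite orbT.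
  have pc : prev c x \in c by rewrite mem_prev.
  have nc : next c x \in c by rewrite mem_next.
  have Hnp : compl_graph G (next c x) (prev c x).
    by rewrite /compl_graph eq_sym pn sW // -?yE // yE eq_sym.
  (* If the two neighbours of [x] were adjacent, three steps of [next] would lead back to [x]. *)
  case: (indc _ _ nc pc Hnp).
    move/(congr1 (next c))/eqP.
    by rewrite next_prev // eq_sym (negbTE (next3_neq uc c4 xc)).
  by rewrite prev_next // => ->; rewrite eqxx.
by rewrite -size_filter; apply: uniq_leq_size tW; rewrite filter_uniq.
Qed.

Lemma hole_compl_cover c s : hole (compl_graph G) c -> all_stable G s ->
  covers s c -> size c <= 2 * size s.
Proof.
move=> hc st cov.
have -> : size c = count (fun x => has (fun W : {set 'I_n} => x \in W) s) c.
  by apply/esym/eqP; rewrite -all_count; apply/allP.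
elim: s st {cov} => [|W s IHs] st; first by rewrite count_pred0.
pose P x := has (fun V : {set 'I_n} => x \in V) s.
rewrite (eq_count (a2 := predU (mem W) P)) // mulnS.
rewrite (leq_trans (leq_addr (count (predI (mem W) P) c) _)) // count_predUI.
apply: leq_add; first exact: stable_hole_compl hc (st W (mem_head _ _)).
by apply: IHs => V Vs; apply: st; rewrite inE Vs orbT.
Qed.
End ComplementHoles.

(** * Splitting a stable sum in the absence of a bridge *)

Section Bridges.
Set Implicit Arguments.
Unset Strict Implicit.

Variables (n : nat) (G : rel 'I_n).

Lemma no_bridge (c1 c2 : seq 'I_n) :
  (forall i j, i \in c1 -> i \notin c2 -> j \in c2 -> j \notin c1 -> i != j ->
     G i j) \/
  has_bridge (compl_graph G) c1 c2.
Proof.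
pose b := [exists i, exists j, [&& i \in c1, i \notin c2, j \in c2, j \notin c1
  & compl_graph G i j]].
have [/existsP[i /existsP[j /and5P[]]]|nb] := boolP b.
  by right; exists i, j.
left=> i j i1 i2 j2 j1 ij; apply: contraNT nb => Gij.
apply/existsP; exists i; apply/existsP; exists j.
by rewrite i1 i2 j2 j1 /compl_graph ij.
Qed.

(** Without a bridge no stable set meets both differences of the cycles. The sets that meet [c1]
    minus [c2] form [s1], the others [s2]; positivity of [w] puts every vertex in some set. *)
Lemma bridge_or_split (R : realType) (K : fieldType) (c1 c2 : seq 'I_n)
    (w : 'I_n -> nat) d :
  normal_polytope K (stable_set_polytope R G) ->
  stable_sum G (fun i => w i + w i) (d + d) ->
  (forall x, (x \in c1) || (x \in c2) -> 0 < w x) ->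
  (exists s1 s2, [/\ all_stable G s1 /\ all_stable G s2, size s1 + size s2 = d,
    forall x, count (fun W : {set 'I_n} => x \in W) s1
            + count (fun W : {set 'I_n} => x \in W) s2 = w x,
    covers s1 [seq x <- c1 | x \notin c2]
    & covers s2 [seq x <- c2 | x \notin c1]])
  \/ has_bridge (compl_graph G) c1 c2.
Proof.
move=> nQ w2 w_gt0; have [join|] := no_bridge c1 c2; last by right.
left; have [s [st sd sw]] := stable_sum_half nQ w2.
pose a (W : {set 'I_n}) := has (fun x => x \in W) [seq x <- c1 | x \notin c2].
exists (filter a s), (filter (predC a) s).
have s_gt0 x : (x \in c1) || (x \in c2) -> exists2 W, W \in s & x \in W.
  by move=> /w_gt0; rewrite -sw -has_count => /hasP.
split.
- by split=> W; rewrite mem_filter => /andP[_ /st].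
- by rewrite !size_filter count_predC.
- by move=> x; rewrite -count_cat -sw; apply/permP; rewrite perm_filterC.
- move=> x xc; have [|W Ws xW] := s_gt0 x.
    by move: xc; rewrite mem_filter => /andP[_ ->].
  by apply/hasP; exists W; rewrite // mem_filter Ws andbT; apply/hasP; exists x.
move=> y; rewrite mem_filter => /andP[y1 y2]; have [|W Ws yW] := s_gt0 y.
  by rewrite y2 orbT.
apply/hasP; exists W; rewrite // mem_filter Ws andbT; apply/hasP => -[x].
rewrite mem_filter => /andP[x2 x1] xW.
have xy : x != y by apply: contraNneq y1 => <-.
by have := st W Ws x y xW yW xy; rewrite join.
Qed.

(** Two sets that cover all vertices but the head leave the head uncovered. *)
Lemma odd_hole_cover c s : is_simple_graph G -> odd_hole G c ->
  all_stable G s -> covers s c -> 2 < size s.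
Proof.
move=> simpleG; case: c => [[[]]//|v c] hc st cov.
have [|_ _ k0] := odd_cycle_cover simpleG hc st.
  by move=> x xc; apply: cov; rewrite inE xc orbT.
rewrite ltnNge; apply/negP => /k0 /eqP; apply/negP.
by rewrite -lt0n -has_count cov ?mem_head.
Qed.

Lemma covers_disjoint (c1 c2 : seq 'I_n) s : [disjoint c1 & c2] ->
  covers s [seq x <- c1 | x \notin c2] -> covers s c1.
Proof.
by move=> dis cov x xc; apply: cov; rewrite mem_filter xc (disjointFr dis).
Qed.

End Bridges.

(** * The three bridge conditions *)

Theorem proposition2p4 (R : realType) (K : fieldType) (n : nat) (G : rel 'I_n)
    (simpleG : is_simple_graph G)
    (normalQ : normal_polytope K (stable_set_polytope R G)) :
  [/\ (forall c1 c2 : seq 'I_n,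
         odd_antihole (compl_graph G) c1 -> odd_antihole (compl_graph G) c2 ->
         [disjoint c1 & c2] ->
         has_bridge (compl_graph G) c1 c2),
      (forall c1 c2 : seq 'I_n,
         odd_antihole (compl_graph G) c1 -> odd_antihole (compl_graph G) c2 ->
         (7 <= size c1)%N -> (7 <= size c2)%N ->
         #|[predI c1 & c2]| = 1%N ->
         has_bridge (compl_graph G) c1 c2)
    & (forall c1 c2 : seq 'I_n,
         odd_hole (compl_graph G) c1 -> odd_antihole (compl_graph G) c2 ->
         [disjoint c1 & c2] ->
         has_bridge (compl_graph G) c1 c2)].
Proof.
rewrite /odd_antihole /antihole compl_graphK //; split=> c1 c2 h1 h2.
- move=> dis.
  have [|x|[s1 [s2 [[st1 st2] sz _ cov1 cov2]]]|//] :=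
    bridge_or_split (c1 := c1) (c2 := c2)
      (w := fun x => (x \in c1) + (x \in c2)) (d := 5) normalQ.
  + apply: eq_stable_sum (stable_sumD (odd_hole_coloring h1)
                                      (odd_hole_coloring h2)).
    by move=> x; lia.
  + by case: (x \in c1); case: (x \in c2).
  have := odd_hole_cover simpleG h1 st1 (covers_disjoint dis cov1).
  rewrite disjoint_sym in dis.
  have := odd_hole_cover simpleG h2 st2 (covers_disjoint dis cov2).
  by lia.
- move=> s1_ge7 s2_ge7 /mem_card1[v vP].
  have /andP[/= v1 v2] : v \in [predI c1 & c2] by rewrite vP inE.
  have [c1' h1' p1] := odd_hole_rot h1 v1.
  have [c2' h2' p2] := odd_hole_rot h2 v2.
  rewrite -(perm_size p1) in s1_ge7; rewrite -(perm_size p2) in s2_ge7.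
  have tail_in (c c' : seq 'I_n) x : odd_hole G (v :: c') ->
      perm_eq (v :: c') c -> x \in c' -> (x \in c) && (x != v).
    case=> [[[/andP[_ /= /andP[vc _]] _] _] _] pc xc.
    by rewrite -(perm_mem pc) inE xc orbT; apply: contraNneq vc => <-.
  have [|x|[s1 [s2 [[st1 st2] sz cnt cov1 cov2]]]|//] :=
    bridge_or_split (c1 := c1) (c2 := c2)
      (w := fun x => (x == v) + (x \in c1) + (x \in c2)) (d := 5) normalQ.
  (* Each colouring gives 3 at [v], in total 6, which is twice the weight of [v]. *)
  + apply: eq_stable_sum (stable_sumD (odd_hole_coloring3 h1' s1_ge7)
                                      (odd_hole_coloring3 h2' s2_ge7)).
    move=> x; rewrite (perm_mem p1) (perm_mem p2).
    by case: (x == v); case: (x \in c1); case: (x \in c2).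
  + by case: (x \in c1); case: (x \in c2); rewrite ?addn1 ?addn0.
  have cov1' : covers s1 c1'.
    move=> x /(tail_in c1 _ _ h1' p1) /andP[x1 xv]; apply: cov1.
    rewrite mem_filter x1 andbT; have := vP x.
    by rewrite !inE x1 (negbTE xv) => /= ->.
  have cov2' : covers s2 c2'.
    move=> x /(tail_in c2 _ _ h2' p2) /andP[x2 xv]; apply: cov2.
    rewrite mem_filter x2 andbT; have := vP x.
    by rewrite !inE x2 (negbTE xv) andbT => /= ->.
  have := cnt v; rewrite eqxx v1 v2 /=.
  have [] := odd_cycle_cover simpleG h1' st1 cov1'.
  have [] := odd_cycle_cover simpleG h2' st2 cov2'.
  (* One side has exactly two sets, none of them at [v]; the other has three, at most two of them at
     [v], short of the weight 3. *)
  move: sz; move: (size s1) (size s2) (count _ s1) (count _ s2); lia.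
move=> dis.
have [|x|[s1 [s2 [[st1 st2] sz _ cov1 cov2]]]|//] :=
  bridge_or_split (c1 := c1) (c2 := c2)
    (w := fun x => (x \in c1) + (x \in c2)) (d := (size c1)./2 + 3) normalQ.
(* For [size c1 = 2k+1], twice [k+3] counts the edges of [c1] and the five colour classes of
   [c2]. *)
- have -> : (size c1)./2 + 3 + ((size c1)./2 + 3) = size c1 + 5.
    by have := odd_double_half (size c1); rewrite h1.2; lia.
  apply: eq_stable_sum (stable_sumD (hole_compl_edges h1.1 simpleG)
                                    (odd_hole_coloring h2)).
  by move=> x; lia.
- by case: (x \in c1); case: (x \in c2).
have := hole_compl_cover h1.1 st1 (covers_disjoint dis cov1).
rewrite disjoint_sym in dis.
have := odd_hole_cover simpleG h2 st2 (covers_disjoint dis cov2).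
have := odd_double_half (size c1); rewrite h1.2; lia.
Qed.
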